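(* Let $\Lambda$ be a preordered set that has finite neighborhoods and let $P$ be a finite commutative ring with the discrete topology. If $G$ is a totally disconnected, locally compact, second countable group having $\mathrm{GL}_\Lambda(P)$ as an open compact subgroup (i.e. an open compact subgroup of $G$ is topologically isomorphic to $\mathrm{GL}_\Lambda(P)$), then $G$ is an elementary group with $\xi(G)\leqslant 3$.
   Context: A preordered set $(\Lambda,\preceq)$ has finite neighborhoods if for every $s\in\Lambda$ the set $\mathcal{N}_1(s)=\{t: t\preceq s\text{ or }s\preceq t\}$ is finite; in particular all intervals $[s_1,s_2]=\{t: s_1\preceq t\preceq s_2\}$ are then finite. Rings have an identity and are nontrivial. The incidence ring is $\mathrm{M}_\Lambda(P)=\{(a_{s_1,s_2})\in P^{\Lambda\times\Lambda}: a_{s_1,s_2}\neq 0\Rightarrow s_1\preceq s_2\}$ with coordinatewise addition and multiplication $(ab)_{s_1,s_2}=\sum_{t\in[s_1,s_2]}a_{s_1,t}b_{t,s_2}$. $\mathrm{GL}_\Lambda(P)$ is its group of units, with the subspace topology from the product topology on $P^{\Lambda\times\Lambda}$. Write t.d.l.c.s.c. for totally disconnected, locally compact, second countable (Hausdorff). The class $\mathcal{E}$ of elementary groups is the smallest class of t.d.l.c.s.c. groups such that: (i) $\mathcal{E}$ contains all second countable profinite groups and all countable discrete groups; (ii) $\mathcal{E}$ is closed under group extensions: if $N\trianglelefteq H$ is a closed normal subgroup of the t.d.l.c.s.c. group $H$ with $N\in\mathcal{E}$ and $H/N\in\mathcal{E}$, then $H\in\mathcal{E}$; (iii) $\mathcal{E}$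 is closed under closed subgroups; (iv) $\mathcal{E}$ is closed under quotients by closed normal subgroups; (v) if a t.d.l.c.s.c. group $G$ is the union of an increasing sequence $(O_i)_{i\in\mathbb{N}}$ of open subgroups with each $O_i\in\mathcal{E}$, then $G\in\mathcal{E}$. The rank $\xi$ is Wesolek's decomposition rank, the unique ordinal-valued function on $\mathcal{E}$ with $\xi(\{1\})=1$ and, for $G\neq\{1\}$ written as the union of an increasing sequence $(O_i)_{i\in\mathbb{N}}$ of compactly generated open subgroups, $\xi(G)=\sup_i\xi(\mathrm{Res}(O_i))+1$, where $\mathrm{Res}(O)$ is the intersection of all open normal subgroups of $O$. *)

(* Defs.v *)
From HB Require Import structures.
From mathcomp Require Import all_boot all_order all_algebra.
From mathcomp Require Import mathcomp_extra boolp classical_sets functions.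
From mathcomp Require Import cardinality fsbigop topology.

Set Implicit Arguments.
Unset Strict Implicit.
Unset Printing Implicit Defensive.

Import Order.TTheory GRing.Theory.

Local Open Scope classical_set_scope.

(* Ordinals, represented by well-founded trees: [strict_sup f] is the least   *)
(* ordinal strictly above all the [f i]. Distinct trees may represent the     *)
(* same ordinal, so equality of ordinals is [oeq] rather than [=].            *)
Inductive ordnum : Type := strict_sup (X : Type) (f : X -> ordnum).

Definition branch (a : ordnum) : Type := let: @strict_sup X _ := a in X.

Definition subtree (a : ordnum) : branch a -> ordnum :=
  match a with @strict_sup X f => f end.

Fixpoint ole (a b : ordnum) : Prop :=
  match a, b with
  | @strict_sup X f, @strict_sup Y g => forall i, exists j, ole (f i) (g j)
  end.

Definition oeq (a b : ordnum) : Prop := ole a b /\ ole b a.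

Definition ozero : ordnum := @strict_sup Empty_set (fun i => match i with end).

Definition osucc (a : ordnum) : ordnum := @strict_sup unit (fun=> a).

Definition olt (a b : ordnum) : Prop := ole (osucc a) b.

Definition osup (I : Type) (f : I -> ordnum) : ordnum :=
  @strict_sup {i : I & branch (f i)} (fun p => subtree (tagged p)).

Definition onat (n : nat) : ordnum := iter n osucc ozero.

Lemma ole_refl a : ole a a.
Proof. by elim: a => X f IH /= i; exists i. Qed.

Lemma ole_trans b a c : ole a b -> ole b c -> ole a c.
Proof.
elim: b a c => Y g IH [X f] [Z h] /= ab bc i.
by have [j /IH abj] := ab i; have [k /abj] := bc j; exists k.
Qed.

Lemma oleP a b : ole a b <-> forall i : branch a, olt (subtree i) b.
Proof.
by case: a b => X f [Y g]; split=> /= ab i; [move=> _|]; exact: ab.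
Qed.

Lemma olt_subtree a (i : branch a) : olt (subtree i) a.
Proof. by case: a i => X f /= i _; exists i; exact: ole_refl. Qed.

Lemma ole_total a b : ole a b \/ olt b a.
Proof.
elim: a b => X f IH b.
have [?|] := pselect (forall i, olt (f i) b); first by left; exact/oleP.
move=> /existsNP[i nlt]; right=> -[]; exists i; apply/oleP => j.
have [ij|//] := IH i (subtree j).
by case: nlt; case: b j ij => Y g /= j ij _; exists j.
Qed.

Lemma olt_wf : well_founded olt.
Proof.
suff acc a : forall b, ole b a -> Acc olt b by move=> a; exact/acc/ole_refl.
elim: a => X f IH [Y g] ba; constructor => c /(_ tt)[j cj].
by have [i fi] := ba j; exact: (IH i _ (ole_trans cj fi)).
Qed.

Lemma olt_irrefl a : ~ olt a a.
Proof. by move: a; apply: (well_founded_ind olt_wf) => a IH aa; exact: (IH a aa aa). Qed.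

Lemma osup_ub I (f : I -> ordnum) i : ole (f i) (osup f).
Proof.
by apply/oleP => j _; exists (existT (fun i => branch (f i)) i j); exact: ole_refl.
Qed.

Lemma osup_le I (f : I -> ordnum) b : (forall i, ole (f i) b) -> ole (osup f) b.
Proof. by move=> fb; apply/oleP => -[i j]; have /oleP := fb i; exact. Qed.

Lemma osucc_mono a b : ole a b -> ole (osucc a) (osucc b).
Proof. by move=> ab _; exists tt. Qed.

#[short(type="preTopologicalGroupType")]
HB.structure Definition PreTopologicalGroup := {G of Group G & Topological G}.

HB.mixin Record PreTopologicalGroup_isTopologicalGroup G
    & PreTopologicalGroup G := {
  mulg_continuous : continuous (fun xy : G * G => (xy.1 * xy.2)%g) ;
  invg_continuous : continuous (fun x : G => x^-1%g)
}.

#[short(type="topologicalGroupType")]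
HB.structure Definition TopologicalGroup :=
  {G of PreTopologicalGroup G & PreTopologicalGroup_isTopologicalGroup G}.

Definition topologically_isomorphic (G H : preTopologicalGroupType) : Prop :=
  exists (f : G -> H) (g : H -> G),
    [/\ {morph f : x y / (x * y)%g}, cancel f g, cancel g f,
        continuous f & continuous g].

Record subgroup (G : groupType) := Subgroup {
  subgroup_set :> set G;
  subgroup_closed : group_closed (mem subgroup_set)
}.

Definition subgroup_type (G : groupType) (H : subgroup G) : Type :=
  set_type H.

Section subgroup_group.
Variables (G : groupType) (H : subgroup G).

HB.instance Definition _ := SubChoice.on (subgroup_type H).
HB.instance Definition _ :=
  SubChoice_isSubGroup.Build G _ (subgroup_type H) (subgroup_closed H).

End subgroup_group.

Section subgroup_topology.
Variables (G : topologicalGroupType) (H : subgroup G).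

HB.instance Definition _ := Topological.copy (subgroup_type H) (set_type H).

HB.instance Definition _ := PreTopologicalGroup.on (subgroup_type H).

Lemma subgroup_val_continuous : continuous (val : subgroup_type H -> G).
Proof. exact: initial_continuous. Qed.

Lemma subgroup_continuousP (T : topologicalType) (f : T -> subgroup_type H) :
  continuous (val \o f) -> continuous f.
Proof. exact: continuous_comp_initial. Qed.

Let mulg_cts : continuous (fun xy : subgroup_type H * subgroup_type H =>
  (xy.1 * xy.2)%g).
Proof.
apply: subgroup_continuousP => xy.
apply: (@continuous_comp _ (G * G)%type G
  (fun xy : subgroup_type H * subgroup_type H => (val xy.1, val xy.2))
  (fun uv => (uv.1 * uv.2)%g)); last exact: mulg_continuous.
apply: cvg_pair; apply: continuous_comp.
- exact: cvg_fst.
- exact: subgroup_val_continuous.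
- exact: cvg_snd.
- exact: subgroup_val_continuous.
Qed.

Let invg_cts : continuous (fun x : subgroup_type H => x^-1%g).
Proof.
apply: subgroup_continuousP => x.
have -> : val \o (fun x : subgroup_type H => x^-1%g) =
    (fun u : G => u^-1%g) \o val.
  by apply/funext => u; exact: (gmulfV (val : subgroup_type H -> G)).
apply: continuous_comp; first exact: subgroup_val_continuous.
exact: invg_continuous.
Qed.

HB.instance Definition _ :=
  PreTopologicalGroup_isTopologicalGroup.Build (subgroup_type H)
    mulg_cts invg_cts.

End subgroup_topology.

Definition normal_subgroup (G : groupType) (N : subgroup G) : Prop :=
  forall x y : G, subgroup_set N x -> subgroup_set N (x ^ y)%g.

(* [q] exhibits [Q] as the topological quotient group [G / N]; quotients are  *)
(* thus taken up to topological isomorphism, which makes [elementary] below   *)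
(* invariant under topological isomorphism (take [N] trivial).                *)
Definition is_quotient_map (G Q : topologicalGroupType) (N : subgroup G)
    (q : G -> Q) : Prop :=
  [/\ {morph q : x y / (x * y)%g},
      (forall y, exists x, q x = y),
      continuous q,
      (forall A : set G, open A -> open (q @` A)) &
      (forall x, q x = 1%g <-> subgroup_set N x)].

Definition tdlcsc (G : topologicalGroupType) : Prop :=
  [/\ hausdorff_space G, totally_disconnected [set: G],
      locally_compact [set: G] & @second_countable G].

Definition profinite (G : topologicalGroupType) : Prop :=
  [/\ hausdorff_space G, totally_disconnected [set: G] & compact [set: G]].

Definition discrete_group (G : topologicalGroupType) : Prop :=
  forall A : set G, open A.

Definition compactly_generated (G : topologicalGroupType) : Prop :=
  exists2 K : set G, compact K &
    forall H : subgroup G, K `<=` H -> [set: G] `<=` H.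

Definition open_exhaustion (G : topologicalGroupType) (O : nat -> subgroup G) :
    Prop :=
  [/\ (forall i, open (O i : set G)), (forall i, O i `<=` O i.+1) &
      (forall x, exists i, subgroup_set (O i) x)].

Inductive elementary : topologicalGroupType -> Prop :=
| elementary_profinite (G : topologicalGroupType) :
    profinite G -> @second_countable G -> elementary G
| elementary_discrete (G : topologicalGroupType) :
    discrete_group G -> countable [set: G] -> elementary G
| elementary_extension (G Q : topologicalGroupType) (N : subgroup G)
    (q : G -> Q) :
    tdlcsc G -> closed N -> normal_subgroup N -> is_quotient_map N q ->
    elementary (subgroup_type N) -> elementary Q -> elementary G
| elementary_closed_subgroup (G : topologicalGroupType) (H : subgroup G) :
    closed H -> elementary G -> elementary (subgroup_type H)
| elementary_quotient (G Q : topologicalGroupType) (N : subgroup G)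
    (q : G -> Q) :
    closed N -> normal_subgroup N -> is_quotient_map N q ->
    elementary G -> elementary Q
| elementary_union (G : topologicalGroupType) (O : nat -> subgroup G) :
    tdlcsc G -> open_exhaustion O ->
    (forall i, elementary (subgroup_type (O i))) -> elementary G.

Section discrete_residual.
Variable G : topologicalGroupType.

Definition Res_set : set G :=
  \bigcap_(N in [set N : subgroup G | open N /\ normal_subgroup N]) N.

Lemma Res_closed : group_closed (mem Res_set).
Proof.
split=> [|x y /set_mem Rx /set_mem Ry]; apply/mem_set => N oN.
  by have [N1 _] := subgroup_closed N; exact/set_mem.
have [_ NB] := subgroup_closed N.
by apply/set_mem/NB; apply/mem_set; [exact: Rx|exact: Ry].
Qed.

Definition Res : subgroup G := Subgroup Res_closed.

End discrete_residual.

(* The graph of the rank: [decomposition_rank G a] means that [G] is          *)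
(* elementary and that [a] is the value forced at [G] by the recursion. It is *)
(* single-valued, see [decomposition_rank_unique].                            *)
Inductive decomposition_rank : topologicalGroupType -> ordnum -> Prop :=
| rank_trivial (G : topologicalGroupType) (a : ordnum) :
    elementary G -> (forall x : G, x = 1%g) ->
    oeq a (onat 1) -> decomposition_rank G a
| rank_nontrivial (G : topologicalGroupType) (O : nat -> subgroup G)
    (r : nat -> ordnum) (a : ordnum) :
    elementary G -> (exists x : G, x <> 1%g) ->
    open_exhaustion O ->
    (forall i, compactly_generated (subgroup_type (O i))) ->
    (forall i, decomposition_rank
                 (subgroup_type (Res (subgroup_type (O i)))) (r i)) ->
    oeq a (osucc (osup r)) -> decomposition_rank G a.

Section rank_unique.
Implicit Types G H K : topologicalGroupType.

Definition continuous_monomorphism H G (f : H -> G) : Prop :=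
  [/\ {morph f : x y / (x * y)%g}, injective f & continuous f].

Lemma subgroup1 G (H : subgroup G) : subgroup_set H 1%g.
Proof. by have [H1 _] := subgroup_closed H; exact/set_mem. Qed.

Lemma subgroup_div G (H : subgroup G) x y :
  subgroup_set H x -> subgroup_set H y -> subgroup_set H (x / y)%g.
Proof.
by move=> Hx Hy; have [_ HB] := subgroup_closed H; apply/set_mem/HB; exact/mem_set.
Qed.

Lemma morph1 G H (f : H -> G) : {morph f : x y / (x * y)%g} -> f 1%g = 1%g.
Proof. by move=> fM; apply: (mulgI (f 1%g)); rewrite -fM !mulg1. Qed.

Lemma morphV G H (f : H -> G) x :
  {morph f : x y / (x * y)%g} -> f (x^-1)%g = (f x)^-1%g.
Proof. by move=> fM; apply/esym/mulg1_eq; rewrite -fM mulgV morph1. Qed.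

Lemma preim_closed G H (f : H -> G) (N : subgroup G) :
  {morph f : x y / (x * y)%g} ->
  group_closed (mem (f @^-1` subgroup_set N)).
Proof.
move=> fM; split=> [|x y /set_mem Nx /set_mem Ny]; apply/mem_set => /=.
  by rewrite (morph1 fM); exact: subgroup1.
by rewrite fM (morphV _ fM); exact: subgroup_div.
Qed.

Lemma monomorphism_corestrict H G (f : H -> G) (O : subgroup G) :
  continuous_monomorphism f -> (forall x, subgroup_set O (f x)) ->
  exists2 g : H -> subgroup_type O, continuous_monomorphism g &
    forall x, val (g x) = f x.
Proof.
move=> [fM fI fC] fO.
have mO x : f x \in subgroup_set O by exact/mem_set.
pose g x : subgroup_type O := exist _ (f x) (mO x).
exists g => //; split.
- by move=> x y; apply/val_inj; exact: fM.
- by move=> x y /(congr1 val) /fI.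
- exact: subgroup_continuousP.
Qed.

Lemma subgroup_val_mono G (O : subgroup G) :
  continuous_monomorphism (val : subgroup_type O -> G).
Proof.
split; first by [].
  exact: val_inj.
exact: subgroup_val_continuous.
Qed.

Lemma comp_mono K G H (f : H -> G) (g : K -> H) :
  continuous_monomorphism f -> continuous_monomorphism g ->
  continuous_monomorphism (f \o g).
Proof.
move=> [fM fI fC] [gM gI gC]; split=> [x y /=|x y /fI/gI//|x].
  by rewrite gM fM.
by apply: continuous_comp; [exact: gC|exact: fC].
Qed.

Lemma Res_mono H G (f : H -> G) : continuous_monomorphism f ->
  exists g : subgroup_type (Res H) -> subgroup_type (Res G),
    continuous_monomorphism g.
Proof.
move=> fm; have [fM fI fC] := fm.
have [|g gm _] :=
    monomorphism_corestrict (O := Res G) (comp_mono fm (subgroup_val_mono (Res H))).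
  move=> -[x /= /set_mem xR] N [oN nN] /=.
  apply: (xR (Subgroup (preim_closed N fM))); split => /=.
    by move/continuousP: fC; exact.
  by move=> y z /= Ny; rewrite conjgE !fM (morphV _ fM) -conjgE; exact: nN.
by exists g.
Qed.

Lemma generated_subset G (O : nat -> subgroup G) H (f : H -> G) :
  open_exhaustion O -> compactly_generated H -> continuous_monomorphism f ->
  exists i, forall x, subgroup_set (O i) (f x).
Proof.
move=> [oO sO cO] [K cK genK] [fM fI fC].
have sOle i j : (i <= j)%N -> O i `<=` O j.
  move=> /subnKC <-; elim: (j - i)%N => [|k IH]; rewrite ?addn0// addnS.
  exact: subset_trans IH (sO _).
have nearK : \forall i \near \oo, K `<=` (fun x => subgroup_set (O i) (f x)).
  apply: (compact_near_coveringP K).1 => // x _.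
  have [m Om] := cO (f x).
  exists (f @^-1` subgroup_set (O m), [set i | (m <= i)%N]) => /=.
    split; last by exists m.
    apply: open_nbhs_nbhs; split=> //.
    by move/continuousP: fC; exact.
  by move=> [y i] /= [Omy mi]; exact: sOle mi _ Omy.
have [i KO] := filter_ex nearK.
exists i => x; exact: (genK (Subgroup (preim_closed (O i) fM))).
Qed.

Lemma decomposition_rank_le G a : decomposition_rank G a ->
  forall H b (f : H -> G), continuous_monomorphism f ->
  decomposition_rank H b -> ole b a.
Proof.
elim=> {G a} [G a eG G1 [_ a1]|G O r a eG _ exO _ _ IH [_ ra]] H b f fm rHb.
  case: rHb f fm => [{}H {}b _ _ [b1 _] f _|{}H O r {}b _ [x nx] _ _ _ _ f [fM fI _]].
    exact: ole_trans b1 a1.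
  by case: nx; apply: fI; rewrite (G1 (f x)) (G1 (f 1%g)).
case: rHb f fm => [{}H {}b _ _ [b1 _] f _|{}H O' r' {}b _ _ exO' cgO' rO' [br _] f fm].
  apply: ole_trans b1 (ole_trans _ ra).
  by apply: osucc_mono; apply/oleP => -[].
apply: ole_trans br (ole_trans (osucc_mono _) ra).
apply: osup_le => j.
have fjm := comp_mono fm (subgroup_val_mono (O' j)).
have [i fi] := generated_subset exO (cgO' j) fjm.
have [g gm _] := monomorphism_corestrict fjm fi.
have [h hm] := Res_mono gm.
exact: ole_trans (IH i _ _ _ hm (rO' j)) (osup_ub r i).
Qed.

Lemma decomposition_rank_unique G a b :
  decomposition_rank G a -> decomposition_rank G b -> oeq a b.
Proof.
have idm : continuous_monomorphism (id : G -> G) by split=> // x; exact: cvg_id.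
by split; [exact: decomposition_rank_le idm _|exact: decomposition_rank_le idm _].
Qed.

End rank_unique.

Definition finite_neighborhoods d (L : preorderType d) : Prop :=
  forall s : L, finite_set [set t : L | (t <= s)%O \/ (s <= t)%O].

Section incidence_ring.
Variables (d : Order.disp_t) (L : preorderType d).
Variable P : pzRingType.

Local Open Scope ring_scope.

Definition incidence_pred : {pred L * L -> P} :=
  fun a => `[< forall s t, a (s, t) != 0 -> (s <= t)%O >].

Record incidence_matrix := IncidenceMatrix {
  imx :> L * L -> P;
  imxP : imx \in incidence_pred
}.

HB.instance Definition _ := [isSub for imx].
HB.instance Definition _ := [Choice of incidence_matrix by <:].

Lemma incidence_pred_zmod : zmod_closed incidence_pred.
Proof.
split=> [|a b /asboolP ha /asboolP hb]; apply/asboolP => s t.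
  by rewrite eqxx.
apply: contraNT => nst; rewrite subr_eq0.
by rewrite (contraNeq (ha s t) nst) (contraNeq (hb s t) nst).
Qed.
HB.instance Definition _ :=
  GRing.isZmodClosed.Build (L * L -> P)%type incidence_pred incidence_pred_zmod.
HB.instance Definition _ :=
  [SubChoice_isSubZmodule of incidence_matrix by <:].

Lemma imx_eq0 (a : incidence_matrix) s t : ~~ (s <= t)%O -> a (s, t) = 0.
Proof. by apply: contraNeq; move/asboolP: (imxP a); exact. Qed.

Definition order_interval (s t : L) : set L := [set u | (s <= u)%O /\ (u <= t)%O].

Definition imul_val (a b : L * L -> P) : L * L -> P :=
  fun st => \sum_(u \in order_interval st.1 st.2) a (st.1, u) * b (u, st.2).

Lemma imul_valP (a b : incidence_matrix) : imul_val a b \in incidence_pred.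
Proof.
apply/asboolP => s t; apply: contraNT => nst.
rewrite /imul_val fsbig1//= => u [su ut].
by case/negP: nst; exact: le_trans su ut.
Qed.

Definition imul (a b : incidence_matrix) : incidence_matrix :=
  IncidenceMatrix (imul_valP a b).

Lemma ione_valP : (fun st => (st.1 == st.2)%:R) \in incidence_pred.
Proof. by apply/asboolP => s t /=; have [->|] := eqVneq s t; rewrite ?lexx ?eqxx. Qed.

Definition ione : incidence_matrix := IncidenceMatrix ione_valP.

Lemma imulE (r : seq L) (a b : incidence_matrix) s t :
  uniq r -> order_interval s t `<=` [set` r] ->
  imul a b (s, t) = \sum_(u <- r) a (s, u) * b (u, t).
Proof.
move=> ur str; apply: fsbig_fwiden => // u [/= _ nst].
have [su|nsu] := boolP (s <= u)%O; last by rewrite imx_eq0 ?mul0r.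
have [ut|nut] := boolP (u <= t)%O; last by rewrite (imx_eq0 b) ?mulr0.
by case: nst.
Qed.

Hypothesis finL : finite_neighborhoods L.

Lemma interval_finite s t : finite_set (order_interval s t).
Proof. by apply: sub_finite_set (finL s) => u [su _]; right. Qed.

Let sup s t : seq L := finmap.enum_fset (fset_set (order_interval s t)).

Let sup_uniq s t : uniq (sup s t).
Proof. exact: finmap.fset_uniq. Qed.

Let sup_sub s t : order_interval s t `<=` [set` sup s t].
Proof. by move=> u stu /=; rewrite in_fset_set ?inE //; exact: interval_finite. Qed.

Let mem_sup s t u : (u \in sup s t) -> order_interval s t u.
Proof. by rewrite in_fset_set ?inE //; exact: interval_finite. Qed.

Lemma imulA : associative imul.
Proof.
move=> a b c; apply/val_inj/funext => -[s t] /=.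
rewrite -[LHS]/(imul a (imul b c) (s, t)) -[RHS]/(imul (imul a b) c (s, t)).
rewrite !(imulE _ _ (sup_uniq s t) (@sup_sub s t)).
rewrite (eq_big_seq (fun u => \sum_(v <- sup s t) a (s, u) * b (u, v) * c (v, t))).
  rewrite exchange_big; apply: eq_big_seq => v /mem_sup[sv vt].
  rewrite (imulE _ _ (sup_uniq s t)) ?mulr_suml// => u [su uv].
  by apply: sup_sub; split=> //; exact: le_trans uv vt.
move=> u /mem_sup[su ut]; rewrite (imulE _ _ (sup_uniq s t)).
  by rewrite mulr_sumr; apply: eq_bigr => v _; rewrite mulrA.
by move=> v [uv vt]; apply: sup_sub; split=> //; exact: le_trans su uv.
Qed.

Lemma imul1l : left_id ione imul.
Proof.
move=> a; apply/val_inj/funext => -[s t] /=.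
rewrite -[LHS]/(imul ione a (s, t)).
have [st|nst] := boolP (s <= t)%O; last by rewrite !imx_eq0.
rewrite (imulE _ _ (sup_uniq s t) (@sup_sub s t)) (bigD1_seq s) //=; last first.
  by apply: sup_sub; split.
rewrite eqxx mul1r big1 ?addr0// => u; rewrite eq_sym => /negbTE ->.
by rewrite mul0r.
Qed.

Lemma imul1r : right_id ione imul.
Proof.
move=> a; apply/val_inj/funext => -[s t] /=.
rewrite -[LHS]/(imul a ione (s, t)).
have [st|nst] := boolP (s <= t)%O; last by rewrite !imx_eq0.
rewrite (imulE _ _ (sup_uniq s t) (@sup_sub s t)) (bigD1_seq t) //=; last first.
  by apply: sup_sub; split.
rewrite eqxx mulr1 big1 ?addr0// => u /negbTE ->.
by rewrite mulr0.
Qed.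

Lemma imulDl : left_distributive imul +%R.
Proof.
move=> a b c; apply/val_inj/funext => -[s t] /=.
rewrite -[LHS]/(imul (a + b) c (s, t)).
rewrite -[RHS]/(imul a c (s, t) + imul b c (s, t)).
rewrite !(imulE _ _ (sup_uniq s t) (@sup_sub s t)) -big_split.
by apply: eq_bigr => u _; exact: mulrDl.
Qed.

Lemma imulDr : right_distributive imul +%R.
Proof.
move=> a b c; apply/val_inj/funext => -[s t] /=.
rewrite -[LHS]/(imul a (b + c) (s, t)).
rewrite -[RHS]/(imul a b (s, t) + imul a c (s, t)).
rewrite !(imulE _ _ (sup_uniq s t) (@sup_sub s t)) -big_split.
by apply: eq_bigr => u _; exact: mulrDr.
Qed.

End incidence_ring.

(* Finiteness of the intervals is what makes the product associative, whence  *)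
(* the dependence of the ring on [finL].                                      *)
Definition incidence d (L : preorderType d) (finL : finite_neighborhoods L)
  (P : pzRingType) : Type := incidence_matrix L P.

HB.instance Definition _ d (L : preorderType d)
    (finL : finite_neighborhoods L) (P : pzRingType) :=
  GRing.Zmodule.on (incidence finL P).
HB.instance Definition _ d (L : preorderType d)
    (finL : finite_neighborhoods L) (P : pzRingType) :=
  GRing.Zmodule_isPzRing.Build (incidence finL P) (imulA finL) (imul1l finL)
    (imul1r finL) (imulDl finL) (imulDr finL).

(* The library attaches a group of units only to finite rings.                *)
Section units.
Variable R : pzRingType.
Local Open Scope ring_scope.

Record units := Units {
  units_val : R;
  units_valP : `[< exists y, units_val * y = 1 /\ y * units_val = 1 >]
}.

HB.instance Definition _ := [isSub for units_val].
HB.instance Definition _ := [Choice of units by <:].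

Lemma units1P : `[< exists y : R, 1 * y = 1 /\ y * 1 = 1 >].
Proof. by apply/asboolP; exists 1; rewrite mul1r. Qed.

Lemma unitsMP (x y : units) : `[< exists z : R,
  units_val x * units_val y * z = 1 /\ z * (units_val x * units_val y) = 1 >].
Proof.
case: x y => x /= /asboolP[x' [xx' x'x]] [y /= /asboolP[y' [yy' y'y]]].
apply/asboolP; exists (y' * x'); split.
  by rewrite mulrA -(mulrA x) yy' mulr1.
by rewrite mulrA -(mulrA y') x'x mulr1.
Qed.

Definition units_inv_val (x : units) : R := sval (cid (asboolW (units_valP x))).

Lemma units_inv_valP (x : units) :
  units_val x * units_inv_val x = 1 /\ units_inv_val x * units_val x = 1.
Proof. by rewrite /units_inv_val; case: cid. Qed.

Lemma unitsVP (x : units) :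
  `[< exists y : R, units_inv_val x * y = 1 /\ y * units_inv_val x = 1 >].
Proof. by apply/asboolP; exists (units_val x); have [? ?] := units_inv_valP x. Qed.

Definition units_one : units := Units units1P.
Definition units_mul (x y : units) : units := Units (unitsMP x y).
Definition units_inv (x : units) : units := Units (unitsVP x).

Let mulA : associative units_mul.
Proof. by move=> x y z; apply/val_inj; exact: mulrA. Qed.
Let mul1 : left_id units_one units_mul.
Proof. by move=> x; apply/val_inj; exact: mul1r. Qed.
Let mulr1 : right_id units_one units_mul.
Proof. by move=> x; apply/val_inj; exact: mulr1. Qed.
Let mulV : left_inverse units_one units_inv units_mul.
Proof. by move=> x; apply/val_inj; have [] := units_inv_valP x. Qed.
Let mulrV : right_inverse units_one units_inv units_mul.
Proof. by move=> x; apply/val_inj; have [] := units_inv_valP x. Qed.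

HB.instance Definition _ := isGroup.Build units mulA mul1 mulr1 mulV mulrV.

End units.

Definition GL d (L : preorderType d) (finL : finite_neighborhoods L)
  (P : pzRingType) : Type := units (incidence finL P).

Definition GL_entries d (L : preorderType d) (finL : finite_neighborhoods L)
    (P : pzRingType) (g : GL finL P) : {ptws L * L -> discrete_topology P} :=
  imx (units_val g).

HB.instance Definition _ d (L : preorderType d)
    (finL : finite_neighborhoods L) (P : pzRingType) := Group.on (GL finL P).
HB.instance Definition _ d (L : preorderType d)
    (finL : finite_neighborhoods L) (P : pzRingType) :=
  Topological.copy (GL finL P) (initial_topology (@GL_entries _ _ finL P)).
HB.instance Definition _ d (L : preorderType d)
    (finL : finite_neighborhoods L) (P : pzRingType) :=
  PreTopologicalGroup.on (GL finL P).

(* Main.v *)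
(* Truncating a matrix to a finite convex block (and completing it by the     *)
(* identity) is a multiplicative endomorphism of the incidence ring. The      *)
(* kernels of these maps form a basis of open normal subgroups of GL, and the *)
(* truncated matrices are dense, each of them commuting with an open subgroup *)
(* because neighborhoods are finite. So the quasicenter of U (the elements    *)
(* with open centralizer) is dense in U, and N, the closure of the quasicenter*)
(* of G, is an open normal subgroup containing U. A compact subset of N meets *)
(* finitely many cosets q U with q quasicentral, hence normalizes all small   *)
(* U-normalized subgroups: compactly generated groups K injecting into N have *)
(* arbitrarily small open normal subgroups, so Res(K) is trivial. Therefore   *)
(* closed subgroups of N have rank at most 2, and since Res(O) lies in N for  *)
(* every open subgroup O of G, the rank of G is at most 3.                    *)
Require Import Defs.
From HB Require Import structures.
From mathcomp Require Import all_boot all_order all_algebra.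
From mathcomp Require Import boolp classical_sets functions.
From mathcomp Require Import cardinality fsbigop topology.

Set Implicit Arguments.
Unset Strict Implicit.
Unset Printing Implicit Defensive.

Import Order.TTheory GRing.Theory.

Local Open Scope classical_set_scope.

(** Every finite set of positions lies in a block $B\times B$ with $B$ finite and convex, and for
    convex $B$ the entries of a product inside the block involve only entries inside it, so
    truncation is multiplicative ([truncationM]). Its kernels on $\mathrm{GL}_\Lambda(P)$ are open
    normal subgroups shrinking to $1$ ([nbhs1_GL_block]). A truncated matrix commutes with all
    matrices trivial on the finite neighborhood of $B$ ([supported_comm]), so elements with open
    centralizer are dense ([GL_quasicentral_dense]).

    These two facts, transported to $U$, drive the rest. Let $N$ be the closure of the quasicenter
    of $G$. A quasicentral element fixes every small subgroup pointwise, and $U$ preserves those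
    that it normalizes; hence the points near a given element of $N$ normalize all small
    $U$-normalized subgroups ([near_normalizer]). Compactness makes this uniform over a compact
    generating set ([small_open_normal]). So compactly generated open subgroups of $N$ are
    compact-by-discrete, which makes $N$ and then $G$ elementary, and their residuals vanish
    ([Res_trivial]). The rank is $1$ for these residuals, at most $2$ for subgroups of $N$, and at
    most $3$ for $G$, because residuals of open subgroups of $G$ lie in $N$. *)

(** * Truncation of incidence matrices to a block *)

Section block_truncation.
Context {d : Order.disp_t} {L : preorderType d}.
Variables (finL : finite_neighborhoods L) (P : pzRingType).
Local Open Scope ring_scope.
Implicit Types (a b z : incidence finL P) (s t u : L) (B : set L).

Definition order_convex B :=
  forall s t u, B s -> B t -> (s <= u)%O -> (u <= t)%O -> B u.

Definition diag s t : P := (s == t)%:R.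

Lemma diag_neq s t : s <> t -> diag s t = 0.
Proof. by rewrite /diag; case: eqP. Qed.

Lemma diag_nle s t : ~~ (s <= t)%O -> diag s t = 0.
Proof. by move=> nst; apply: diag_neq => st; move: nst; rewrite st lexx. Qed.

Definition supported B a := forall s t, ~ (B s /\ B t) -> imx a (s, t) = diag s t.

Lemma mul_entry_eq a b a' b' s t :
  (forall u, (s <= u)%O -> (u <= t)%O ->
     imx a (s, u) * imx b (u, t) = imx a' (s, u) * imx b' (u, t)) ->
  imx (a * b) (s, t) = imx (a' * b') (s, t).
Proof. by move=> ab; apply: eq_fsbigr => u /set_mem [su ut]; exact: ab. Qed.

Lemma mul_row_diag a b s t :
  (forall u, imx a (s, u) = diag s u) -> imx (a * b) (s, t) = imx b (s, t).
Proof.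
by move=> as1; rewrite -[b in RHS]mul1r; apply: mul_entry_eq => u _ _; rewrite as1.
Qed.

Lemma mul_col_diag a b s t :
  (forall u, imx b (u, t) = diag u t) -> imx (a * b) (s, t) = imx a (s, t).
Proof.
by move=> bt1; rewrite -[a in RHS]mulr1; apply: mul_entry_eq => u _ _; rewrite bt1.
Qed.

Definition truncation_val B (a : incidence finL P) : L * L -> P :=
  fun st => if pselect (B st.1 /\ B st.2) then imx a st else diag st.1 st.2.

Lemma truncation_valP B a : truncation_val B a \in @incidence_pred _ L P.
Proof.
apply/asboolP => s t; apply: contraNT => nst; rewrite /truncation_val /=; apply/eqP.
case: pselect => ? /=; first by rewrite imx_eq0.
exact: diag_nle.
Qed.

Definition truncation B a : incidence finL P :=
  IncidenceMatrix (truncation_valP B a).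

Lemma truncation_in B a s t : B s -> B t ->
  imx (truncation B a) (s, t) = imx a (s, t).
Proof. by move=> Bs Bt /=; rewrite /truncation_val; case: pselect => // -[]. Qed.

Lemma truncation_supported B a : supported B (truncation B a).
Proof. by move=> s t Bst /=; rewrite /truncation_val; case: pselect. Qed.

Lemma incidence_ext a b : (forall s t, imx a (s, t) = imx b (s, t)) -> a = b.
Proof. by move=> ab; apply/val_inj/funext => -[s t]; exact: ab. Qed.

Lemma truncation1 B : truncation B 1 = 1.
Proof.
by apply: incidence_ext => s t /=; rewrite /truncation_val; case: pselect.
Qed.

(** Convexity keeps the whole interval between two points of $B$ inside $B$; outside the block, a
    row or a column of both factors is that of the identity. *)
Lemma truncationM B a b : order_convex B ->
  truncation B (a * b) = truncation B a * truncation B b.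
Proof.
move=> cB; apply: incidence_ext => s t.
have [Bs|nBs] := pselect (B s); last first.
  rewrite mul_row_diag => [|u]; rewrite !truncation_supported //; tauto.
have [Bt|nBt] := pselect (B t); last first.
  rewrite mul_col_diag => [|u]; rewrite !truncation_supported //; tauto.
rewrite truncation_in //; apply: mul_entry_eq => u su ut.
by have Bu := cB _ _ _ Bs Bt su ut; rewrite !truncation_in.
Qed.

Definition neighborhood B : set L :=
  [set t | exists2 s, B s & (t <= s)%O \/ (s <= t)%O].

Lemma neighborhood_finite B : finite_set B -> finite_set (neighborhood B).
Proof.
move=> fB.
apply: (sub_finite_set _ (bigcup_finite fB (fun s _ => finL s))) => t [s Bs st].
by exists s.
Qed.

(** Everything comparable to a point of $B$ lies in the neighborhood, so the rows and columns of $z$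
    indexed by $B$ are those of the identity. Thus $a$ and $z$ differ from the identity on disjoint
    diagonal blocks. *)
Lemma supported_comm B a z : supported B a ->
  (forall s t, neighborhood B s -> neighborhood B t -> imx z (s, t) = diag s t) ->
  a * z = z * a.
Proof.
move=> Ba z1.
have nbB s : B s -> neighborhood B s by exists s => //; left.
have zl s t : B s -> imx z (s, t) = diag s t.
  move=> Bs; have [st|nst] := boolP (s <= t)%O.
    by apply: z1; [exact: nbB|exists s => //; right].
  by rewrite imx_eq0 // diag_nle.
have zr s t : B t -> imx z (s, t) = diag s t.
  move=> Bt; have [st|nst] := boolP (s <= t)%O.
    by apply: z1; [exists t => //; left|exact: nbB].
  by rewrite imx_eq0 // diag_nle.
apply: incidence_ext => s t.
have [Bs|nBs] := pselect (B s).
  rewrite [RHS](mul_row_diag _ _ (fun u => zl s u Bs)) -[a in RHS]mulr1.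
  apply: mul_entry_eq => u _ _; have [Bu|nBu] := pselect (B u).
    by rewrite zl.
  have us : s <> u by move=> su; case: nBu; rewrite -su.
  by rewrite Ba ?(diag_neq us) ?mul0r //; tauto.
rewrite [LHS]mul_row_diag => [|u]; last by apply: Ba; tauto.
have [Bt|nBt] := pselect (B t); last first.
  by rewrite [RHS]mul_col_diag => [//|u]; apply: Ba; tauto.
(* With $s\notin B$ and $t\in B$, both matrices have the entry of the identity at $(s,t)$, so the
   entry of $z$ can be traded for that of $a$. *)
rewrite zr // -(Ba s t); last tauto.
rewrite -[a in LHS]mul1r; apply: mul_entry_eq => u _ _.
have [Bu|nBu] := pselect (B u); first by rewrite zr.
have ut : u <> t by move=> ut; case: nBu; rewrite ut.
rewrite Ba ?(diag_neq ut) ?mulr0 //; tauto.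
Qed.

End block_truncation.

(** * Neighborhoods in GL: finitely many prescribed entries *)

Section GL_topology.
Context {d : Order.disp_t} {L : preorderType d}.
Variables (finL : finite_neighborhoods L) (P : pzRingType).
Implicit Types (g h : GL finL P).

Lemma GL_entry_continuous (p : L * L) :
  continuous (fun g : GL finL P => GL_entries g p : discrete_topology P).
Proof.
move=> g; apply: (@continuous_comp _ _ _ (@GL_entries _ _ finL P)
  (fun e : {ptws L * L -> discrete_topology P} => e p)).
  exact: initial_continuous.
exact: (@proj_continuous _ (fun _ : L * L => discrete_topology P) p).
Qed.

Lemma nbhs_GL_entries g (l : seq (L * L)) :
  \forall h \near g, forall p, p \in l -> GL_entries h p = GL_entries g p.
Proof.
elim: l => [|p l IH]; first exact: filterE.
have gp : \forall h \near g, GL_entries h p = GL_entries g p.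
  exact: (GL_entry_continuous (discrete_set1 (GL_entries g p))).
apply: filterS2 gp IH => h hp hl q; rewrite inE => /predU1P[->//|].
exact: hl.
Qed.

(** The cylinders around the entries of $g$ generate a filter that converges coordinatewise, hence
    in the product topology. *)
Lemma nbhs_GLP g (A : set (GL finL P)) : nbhs g A ->
  exists l : seq (L * L),
    forall h, (forall p, p \in l -> GL_entries h p = GL_entries g p) -> A h.
Proof.
case=> _ [[B oB <-] /= Bg BA].
pose cyl := filter_from [set: seq (L * L)] (fun l =>
  [set e : {ptws L * L -> discrete_topology P} |
    forall p, p \in l -> e p = GL_entries g p]).
have Fcyl : Filter cyl.
  apply: filter_from_filter; first by exists [::].
  move=> l m _ _; exists (l ++ m) => // e el.
  by split=> p pl; apply: el; rewrite mem_cat pl ?orbT.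
have cvg_cyl : cyl --> GL_entries g.
  apply/cvg_sup => p A0.
  case=> _ [[C oC <-] /= Cg CA0]; exists [:: p] => // e /= ep.
  by apply: CA0 => /=; rewrite ep ?inE.
have [l _ lB] : cyl B by apply: cvg_cyl; exact: open_nbhs_nbhs.
by exists l => h hl; apply: BA; exact: lB.
Qed.

End GL_topology.

(** * Block kernels and density of quasicentral elements in GL *)

Section GL_blocks.
Context {d : Order.disp_t} {L : preorderType d}.
Variables (finL : finite_neighborhoods L) (P : pzRingType).
Implicit Types (g h : GL finL P) (B : set L).
Local Open Scope ring_scope.

(** The convex hull is the union of the intervals between the finitely many coordinates, each of
    them finite. *)
Lemma finite_convex_cover (l : seq (L * L)) : exists B : set L,
  [/\ finite_set B, order_convex B & forall p, p \in l -> B p.1 /\ B p.2].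
Proof.
pose pts := [set` [seq p.1 | p <- l] ++ [seq p.2 | p <- l]].
exists (\bigcup_(p in pts `*` pts) order_interval p.1 p.2); split.
- apply: bigcup_finite; first by apply: finite_setX; exact: finite_seq.
  by move=> p _; exact: interval_finite.
- move=> s t u [[a b] /= [pa pb] [a_s s_b]] [[a' b'] /= [pa' pb'] [a't tb']] su ut.
  exists (a, b') => //=; split; first exact: le_trans a_s su.
  exact: le_trans ut tb'.
- move=> p pl; have p1 : pts p.1 by rewrite /pts /= mem_cat map_f.
  have p2 : pts p.2 by rewrite /pts /= mem_cat (map_f snd) ?orbT.
  split; first by exists (p.1, p.1) => //; split; exact: lexx.
  by exists (p.2, p.2) => //; split; exact: lexx.
Qed.

Lemma GL_truncation_subproof B g : order_convex B ->
  `[< exists b : incidence finL P, truncation B (units_val g) * b = 1 /\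
      b * truncation B (units_val g) = 1 >].
Proof.
move=> cB; apply/asboolP; exists (truncation B (units_val g^-1%g)).
by rewrite -!truncationM //; have [-> ->] := units_inv_valP g; rewrite truncation1.
Qed.

Definition block_trivial B g := truncation B (units_val g) = 1.

Lemma block_trivialP B g : block_trivial B g <->
  forall s t, B s -> B t -> imx (units_val g) (s, t) = diag P s t.
Proof.
split=> [g1 s t Bs Bt|g1]; first by rewrite -(truncation_in _ Bs Bt) g1.
apply: incidence_ext => s t; have [[Bs Bt]|Bst] := pselect (B s /\ B t).
  by rewrite truncation_in // g1.
by rewrite truncation_supported.
Qed.

Lemma block_trivial_near B : finite_set B ->
  \forall g \near (1%g : GL finL P), block_trivial B g.
Proof.
move=> fB; have /finite_seqP[l lE] := finite_setX fB fB.
apply: filterS (nbhs_GL_entries (1%g : GL finL P) l) => g gl.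
apply/block_trivialP => s t Bs Bt; apply: gl.
by have : (B `*` B) (s, t) by []; rewrite lE.
Qed.

Lemma block_trivial1 B : block_trivial B 1%g.
Proof. exact: truncation1. Qed.

Lemma block_trivialM B g h : order_convex B ->
  block_trivial B g -> block_trivial B h -> block_trivial B (g * h)%g.
Proof.
by move=> cB g1 h1; rewrite /block_trivial [units_val _]/(_ * _) truncationM // g1 h1 mulr1.
Qed.

Lemma block_trivialV B g : order_convex B ->
  block_trivial B g -> block_trivial B g^-1%g.
Proof.
move=> cB g1; rewrite /block_trivial -[LHS]mul1r -{1}g1 -truncationM //.
by have [-> _] := units_inv_valP g; exact: truncation1.
Qed.

Lemma block_trivialJ B g h : order_convex B ->
  block_trivial B g -> block_trivial B (g ^ h)%g.
Proof.
move=> cB g1; rewrite /block_trivial conjgE.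
rewrite [units_val _]/(units_inv_val h * (units_val g * units_val h)).
rewrite !truncationM // g1 mul1r -truncationM //.
by have [_ ->] := units_inv_valP h; exact: truncation1.
Qed.

Lemma nbhs1_GL_block (A : set (GL finL P)) : nbhs (1%g : GL finL P) A ->
  exists B, [/\ finite_set B, order_convex B & forall g, block_trivial B g -> A g].
Proof.
move=> /nbhs_GLP [l lA]; have [B [fB cB lB]] := finite_convex_cover l.
exists B; split=> // g /block_trivialP g1; apply: lA => -[s t] /lB[/= Bs Bt].
exact: g1.
Qed.

Lemma GL_quasicentral_dense g (A : set (GL finL P)) : nbhs g A ->
  exists2 q, A q & \forall z \near (1%g : GL finL P), (q * z = z * q)%g.
Proof.
move=> /nbhs_GLP [l lA]; have [B [fB cB lB]] := finite_convex_cover l.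
exists (Units (GL_truncation_subproof g cB)).
  apply: lA => -[s t] /lB[/= Bs Bt].
  by have := truncation_in (units_val g) Bs Bt.
apply: filterS (block_trivial_near (neighborhood_finite finL fB)).
move=> z /block_trivialP z1; apply/val_inj.
exact: supported_comm (@truncation_supported _ _ _ _ _ _) z1.
Qed.

End GL_blocks.

(** * Topological groups and the closure of the quasicenter *)

Section topological_groups.
Variable G : topologicalGroupType.
Implicit Types (H N U W : subgroup G) (x y z : G) (A B : set G).
Local Open Scope group_scope.

Lemma mull_continuous x : continuous (fun y => x * y).
Proof.
move=> y; apply: (@continuous_comp _ (G * G)%type G (fun y => (x, y))
  (fun uv => uv.1 * uv.2)); last exact: mulg_continuous.
by apply: cvg_pair; [exact: cvg_cst|exact: cvg_id].
Qed.

Lemma mulr_continuous x : continuous (fun y => y * x).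
Proof.
move=> y; apply: (@continuous_comp _ (G * G)%type G (fun y => (y, x))
  (fun uv => uv.1 * uv.2)); last exact: mulg_continuous.
by apply: cvg_pair; [exact: cvg_id|exact: cvg_cst].
Qed.

Lemma conj_continuous x : continuous (fun y => y ^ x).
Proof.
have -> : (fun y => y ^ x) = (fun y => x^-1 * y) \o (fun y => y * x).
  by apply/funext => y; rewrite conjgE.
by move=> y; apply: continuous_comp; [exact: mulr_continuous|exact: mull_continuous].
Qed.

Lemma subgroupM H x y : subgroup_set H x -> subgroup_set H y -> subgroup_set H (x * y).
Proof.
move=> Hx Hy; rewrite -[y]invgK; apply: subgroup_div => //.
by rewrite -[y^-1]mul1g; apply: subgroup_div => //; exact: subgroup1.
Qed.

Lemma subgroupV H x : subgroup_set H x -> subgroup_set H x^-1.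
Proof.
by move=> Hx; rewrite -[x^-1]mul1g; apply: subgroup_div => //; exact: subgroup1.
Qed.

Lemma nbhs1_mull x A : nbhs 1 A -> nbhs x [set y | A (x^-1 * y)].
Proof. by move=> A1; apply: (@mull_continuous x^-1 x); rewrite mulVg. Qed.

Lemma subgroup_open H : nbhs 1 (H : set G) -> open (H : set G).
Proof.
move=> H1; rewrite openE => x Hx; apply: filterS (nbhs1_mull x H1) => y /= Hxy.
by rewrite -(mulVKg x y); exact: subgroupM.
Qed.

Lemma nbhs1_subgroup H : open (H : set G) -> nbhs 1 (H : set G).
Proof. by move=> oH; apply: open_nbhs_nbhs; split=> //; exact: subgroup1. Qed.

Lemma open_subgroup_closed H : open (H : set G) -> closed (H : set G).
Proof.
move=> /nbhs1_subgroup H1 x /(_ _ (nbhs1_mull x H1)) [y [Hy Hxy]].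
have -> : x = y / (x^-1 * y) by rewrite invgM invgK mulVKg.
exact: subgroup_div.
Qed.

(** Lets properties that hold near $1$ in an open subgroup, such as commuting with a fixed element,
    pass to the whole group. *)
Lemma nbhs_val H (x : subgroup_type H) (A : set (subgroup_type H)) :
  open (H : set G) -> nbhs x A -> nbhs (val x) (val @` A).
Proof.
move=> oH [_ [[B oB <-] /= Bx BA]].
apply: filterS (open_nbhs_nbhs (conj (openI oB oH) (conj Bx (set_mem (valP x))))).
by move=> y [By /mem_set Hy]; exists (exist _ y Hy) => //; exact: BA.
Qed.

Definition quasicenter : set G := [set q | \forall z \near 1, q * z = z * q].

Lemma quasicenter_closed : group_closed (mem (closure quasicenter)).
Proof.
have qzB x y : quasicenter x -> quasicenter y -> quasicenter (x / y).
  move=> qx qy; apply: filterS2 qx qy => z xz yz.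
  rewrite -mulgA; have -> : y^-1 * z = z * y^-1.
    by apply: (mulgI y); rewrite mulVKg mulgA yz mulgK.
  by rewrite mulgA xz mulgA.
split=> [|x y /set_mem cx /set_mem cy]; apply/mem_set.
  by apply: subset_closure; apply: filterE => z; rewrite mul1g mulg1.
move=> A; rewrite -[nbhs _ _]/(nbhs ((fun uv : G * G => uv.1 * uv.2) (x, y^-1)) A).
move=> /mulg_continuous [[A1 A2] /= [xA1 /invg_continuous yA2] A12].
have [a [qa A1a]] := cx _ xA1; have [b [qb /= A2b]] := cy _ yA2.
exists (a / b); split; first exact: qzB.
exact: (A12 (a, b^-1)).
Qed.

Definition quasicentral_closure : subgroup G := Subgroup quasicenter_closed.

(** Conjugation is continuous and carries the centralizer of [q] to that of [q ^ y], so it preserves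
    the quasicenter and its closure. *)
Lemma quasicentral_closure_normal : normal_subgroup quasicentral_closure.
Proof.
move=> x y /= cx A /conj_continuous/cx [q [qq Aq]].
exists (q ^ y); split=> //.
have qy : \forall z \near 1, q * (z ^ y^-1) = (z ^ y^-1) * q.
  have /conj_continuous : nbhs (1 ^ y^-1) [set z | q * z = z * q].
    by rewrite conj1g.
  exact.
apply: filterS qy => z /= /(congr1 (conjg^~ y)).
by rewrite [(q * _) ^ y]conjMg [(_ * q) ^ y]conjMg conjgKV.
Qed.

End topological_groups.

(** * Compactly generated groups inside the closed quasicenter *)

Section dense_quasicenter.
Variables (G : topologicalGroupType) (U : subgroup G).
Local Open Scope group_scope.

Definition normalized_by (W : subgroup G) : Prop :=
  forall u w, subgroup_set U u -> subgroup_set W w -> subgroup_set W (w ^ u).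

Definition small_normalized_subgroups : Prop :=
  forall A : set G, nbhs 1 A -> exists W : subgroup G,
    [/\ open (W : set G), W `<=` A, W `<=` U & normalized_by W].

Hypothesis oU : open (U : set G).
Hypothesis smallU : small_normalized_subgroups.

(** Both [z] and its inverse are constrained: conjugating $W$ into itself by [z] alone would define
    only a monoid. *)
Definition normalizer_set (W : subgroup G) : set G := [set z |
  forall w, subgroup_set W w -> subgroup_set W (w ^ z) /\ subgroup_set W (w ^ z^-1)].

Lemma normalizer_closed W : group_closed (mem (normalizer_set W)).
Proof.
split=> [|x y /set_mem nx /set_mem ny]; apply/mem_set => w Ww.
  by rewrite invg1 conjg1.
rewrite invgM invgK !conjgM; have [wx wxV] := nx w Ww; have [wy wyV] := ny w Ww.
by split; [exact: (ny _ wx).2|exact: (nx _ wy).2].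
Qed.

Definition normalizer W : subgroup G := Subgroup (normalizer_closed W).

(* Near z, every point is a product of one quasicentral element and an        *)
(* element of U, so that it normalizes all small U-normalized subgroups.      *)
Lemma near_normalizer z : closure (@quasicenter G) z ->
  \forall y \near z & A \near powerset_filter_from (nbhs (1 : G)),
    forall W : subgroup G, W `<=` A -> normalized_by W -> normalizer_set W y.
Proof.
move=> /(_ _ (nbhs1_mull z (nbhs1_subgroup oU))) [q [qq /= Uzq]].
exists ([set y | subgroup_set U (z^-1 * y)], [set A | A `<=` [set c | q * c = c * q]]).
  split=> /=; first exact/nbhs1_mull/nbhs1_subgroup.
  exact: small_set_sub.
move=> [y A] /= [Uzy AC] W WA nW w Ww.
have cq c : subgroup_set W c -> c ^ q = c /\ c ^ q^-1 = c.
  move=> /WA/AC /= qc; rewrite !conjgE -qc mulKg invgK; split=> //.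
  by rewrite mulgA qc mulgK.
have [u Uu ->] : exists2 u, subgroup_set U u & y = q * u.
  exists (q^-1 * y); last by rewrite mulVKg.
  have -> : q^-1 * y = (z^-1 * q)^-1 * (z^-1 * y).
    by rewrite invgM invgK -mulgA mulVKg.
  by apply: subgroupM => //; exact: subgroupV.
rewrite invgM !conjgM (cq w Ww).1; split; first exact: (nW _ _ Uu Ww).
have Wwu : subgroup_set W (w ^ u^-1) by apply: (nW _ _ _ Ww); exact: subgroupV.
by rewrite (cq _ Wwu).2.
Qed.

(** Compactness of a generating set $C$ gives one neighborhood of $1$ whose $U$-normalized subgroups
    are normalized by all of $f(C)$, hence by $f(K)$. The preimage of a small one is open and normal
    in $K$. *)
Lemma small_open_normal (K : topologicalGroupType) (f : K -> G) (A : set G) :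
  compactly_generated K -> continuous_monomorphism f ->
  (forall x, closure (@quasicenter G) (f x)) -> nbhs 1 A ->
  exists W : subgroup K, [/\ open (W : set K), normal_subgroup W &
    forall w, subgroup_set W w -> A (f w) /\ subgroup_set U (f w)].
Proof.
move=> [C cC genC] [fM fI fC] fqc A1.
have nearC : \forall B \near powerset_filter_from (nbhs (1 : G)), C `<=` (fun x =>
    forall W : subgroup G, W `<=` B -> normalized_by W -> normalizer_set W (f x)).
  apply: (compact_near_coveringP C).1 => // x _.
  have [[Z F] /= [Zx FF] ZF] := near_normalizer (fqc x).
  exists (f @^-1` Z, F) => /=; first by split=> //; exact: fC.
  by move=> [y B] [/= Zy FB]; exact: (ZF (f y, B)).
have [B [[CB BA] B1]] := filter_ex
  (filterI (filterI nearC (small_set_sub A1)) (near_small_set _)).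
have [W [oW WB WU nW]] := smallU B1.
have normK x : normalizer_set W (f x).
  apply: (genC (Subgroup (preim_closed (normalizer W) fM))) => // {}x Cx.
  exact: CB.
exists (Subgroup (preim_closed W fM)); split=> /=.
- by move/continuousP: fC; exact.
- move=> x y /= Wx; rewrite conjgE !fM (morphV _ fM) -conjgE.
  exact: (normK y _ Wx).1.
- by move=> x Wx; split; [exact/BA/WB|exact: WU].
Qed.

Lemma Res_trivial (K : topologicalGroupType) (f : K -> G) :
  hausdorff_space G -> compactly_generated K -> continuous_monomorphism f ->
  (forall x, closure (@quasicenter G) (f x)) ->
  forall x, subgroup_set (Res K) x -> x = 1.
Proof.
move=> hG cgK fm fqc x Rx; have [fM fI fC] := fm.
apply: fI; rewrite (morph1 fM); apply: contrapT => fx1.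
have A1 : nbhs (1 : G) (~` [set f x]).
  apply: open_nbhs_nbhs; split; last exact: nesym.
  by rewrite openC; exact: (accessible_closed_set1 (hausdorff_accessible hG)).
have [W [oW nW WA]] := small_open_normal cgK fm fqc A1.
by have [/(_ erefl)] := WA x (Rx W (conj oW nW)).
Qed.

End dense_quasicenter.

(** * Closed subgroups inherit compactness and the t.d.l.c.s.c. property *)

Section closed_subgroups.
Variables (G : topologicalGroupType) (H : subgroup G).
Hypothesis cH : closed (H : set G).

Lemma val_preimage_compact (A : set G) :
  compact A -> compact (val @^-1` A : set (subgroup_type H)).
Proof.
move=> cA F PF FA.
have [x [Ax clx]] := cA (val @ F) _ FA.
(* The cluster point found in the ambient group stays in $H$ because $H$ is closed. *)
have Hx : subgroup_set H x.
  apply: cH => V xV; have [y [Hy Vy]] : subgroup_set H `&` V !=set0.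
    apply: clx => //; apply: (@filterE _ F) => y; exact: set_mem (valP y).
  by exists y.
exists (exist _ x (mem_set Hx)); split=> // B V FB [_ [[W oW <-] /= Wx WV]].
have [y [[z Bz <-] Wz]] : (val : subgroup_type H -> G) @` B `&` W !=set0.
  apply: clx; last exact: open_nbhs_nbhs.
  by apply: (@filterS _ F _ B) => // z Bz; exists z.
by exists z; split=> //; exact: WV.
Qed.

Lemma tdlcsc_closed_subgroup : tdlcsc G -> tdlcsc (subgroup_type H).
Proof.
move=> [hG tdG lcG [B cB [oB bB]]].
have vC := @subgroup_val_continuous G H.
have hH : hausdorff_space (subgroup_type H).
  move=> p q pq; apply: val_inj; apply: hG => A A' pA qA'.
  have [z [Az A'z]] := pq _ _ (vC p A pA) (vC q A' qA').
  by exists (val z).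
split=> //.
- move=> x _; apply/seteqP; split=> [y|_ ->]; last exact: connected_component_refl.
  move=> [C [Cx _ cC] Cy]; apply: val_inj.
  have : connected_component [set: G] (val x) (val y).
    exists (val @` C); last by exists y.
    split; [by exists x|by []|].
    apply: connected_continuous_connected => //.
    exact: continuous_subspaceT.
  by rewrite tdG.
- move=> x _; have [A xA [cA clA]] := lcG (val x) I.
  have {}xA : nbhs (val x) A.
    by apply: (@filterS _ (nbhs (val x)) _ [set y | setT y -> A y]) => // y /(_ I).
  exists (val @^-1` A : set (subgroup_type H)).
    have vxA : nbhs x (val @^-1` A) by exact: vC.
    by move: vxA; apply: filterS => y ? _.
  split; first exact: val_preimage_compact.
  by apply: preimage_closed => // y _; exact: vC.
exists [set val @^-1` b | b in B]; first exact: sub_countable (card_image_le _ _) cB.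
split=> [_ [b /oB ob <-]|x A [_ [[V oV <-] /= Vx VA]]].
  by move/continuousP: vC; exact.
have [b [Bb bx] bV] := bB _ V (open_nbhs_nbhs (conj oV Vx)).
exists (val @^-1` b); first by split=> //; exists b.
by move=> y /= by_; apply: VA; exact: bV.
Qed.
End closed_subgroups.

(** * Exhaustion by compactly generated open subgroups *)

Section exhaustion.
Variable G : topologicalGroupType.
Implicit Type S : set G.
Local Open Scope group_scope.

Definition generated_set S : set G :=
  \bigcap_(H in [set H : subgroup G | S `<=` H]) H.

Lemma generated_closed S : group_closed (mem (generated_set S)).
Proof.
split=> [|x y /set_mem Sx /set_mem Sy]; apply/mem_set => H SH.
  exact: subgroup1.
by apply: subgroup_div; [exact: Sx|exact: Sy].
Qed.

Definition generated S : subgroup G := Subgroup (generated_closed S).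

Lemma sub_generated S : S `<=` generated S.
Proof. by move=> x Sx H; exact. Qed.

Lemma generatedS S S' : S `<=` S' -> generated S `<=` generated S'.
Proof. by move=> SS x Sx H /= S'H; apply: Sx; exact: subset_trans S'H. Qed.

Lemma generated_compactly S : compact S -> closed (generated S : set G) ->
  compactly_generated (subgroup_type (generated S)).
Proof.
move=> cS clS; exists (val @^-1` S); first exact: val_preimage_compact.
move=> H SH [x Sx] _.
have HVclosed : group_closed (mem [set y | exists2 z, subgroup_set H z & val z = y]).
  split=> [|y z /set_mem[u Hu <-] /set_mem[v Hv <-]]; apply/mem_set.
    by exists 1%g => //; exact: subgroup1.
  by exists (u / v) => //; exact: subgroup_div.
have [|z Hz zx] := set_mem Sx (Subgroup HVclosed).
  by move=> y Sy; exists (exist _ y (mem_set (sub_generated Sy))) => //; exact: SH.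
by rewrite (_ : exist _ _ _ = z) //; exact/val_inj.
Qed.

Lemma second_countable_dense : @second_countable G ->
  exists x : nat -> G, forall (y : G) (A : set G), nbhs y A -> exists n, A (x n).
Proof.
move=> [B /countable_injP[f fI] [oB bB]].
(* One point is chosen in each nonempty basic set, numbered by [f]; the default $1$ fills the
   remaining indices. *)
exists (fun n => xget 1 [set y | exists2 b, B b & f b = n /\ b y]) => y A yA.
have [b [Bb b_y] bA] := bB y A yA; exists (f b).
have /(@xgetPex _ 1) [b' Bb' [fb' b'x]] :
  exists z, [set y | exists2 b', B b' & f b' = f b /\ b' y] z by exists y, b.
by have b'b := fI _ _ (mem_set Bb') (mem_set Bb) fb'; rewrite b'b in b'x; exact: bA.
Qed.

(** The subgroups are generated by a compact neighborhood $V$ of $1$ and the first terms of a dense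
    sequence. *)
Lemma compactly_generated_exhaustion : tdlcsc G ->
  exists2 O : nat -> subgroup G, open_exhaustion O &
    forall i, compactly_generated (subgroup_type (O i)).
Proof.
move=> [_ _ lcG /second_countable_dense [x dx]].
have [V V1 [cV clV]] := lcG 1%g I.
have {}V1 : nbhs (1 : G) V.
  by apply: (@filterS _ (nbhs (1 : G)) _ [set y | setT y -> V y]) => // y /(_ I).
pose S i := V `|` (x @` `I_i).
have oS i : open (generated (S i) : set G).
  apply: subgroup_open; apply: filterS V1 => y Vy.
  by apply: sub_generated; left.
exists (fun i => generated (S i)).
  split=> // [i|y].
    apply: generatedS; apply: setUS => _ [j /= ji <-]; exists j => //=.
    exact: ltnW.
  (* A nearby [x n] differs from [y] by an element of $V$; the index is [n.+1] since stage $i$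
     contains only the terms of index below $i$. *)
  have [n Vn] := dx y _ (nbhs1_mull y V1); exists n.+1.
  have -> : y = x n / (y^-1 * x n) by rewrite invgM invgK mulVKg.
  apply: subgroup_div; apply: sub_generated; last by left.
  by right; exists n => /=.
move=> i; apply: generated_compactly; last exact: open_subgroup_closed.
by apply: compactU => //; apply: finite_compact; apply: finite_image.
Qed.

End exhaustion.

(** * The discrete quotient by an open normal subgroup *)

Section coset_representative.
Variables (G : topologicalGroupType) (N : subgroup G).
Local Open Scope group_scope.

Definition coset_rep (x : G) : G := xget 1 [set y | subgroup_set N (x^-1 * y)].

Lemma coset_rep_in x : subgroup_set N (x^-1 * coset_rep x).
Proof.
apply: (xgetPex 1 (P := [set y | subgroup_set N (x^-1 * y)])); exists x => /=.
by rewrite mulVg; exact: subgroup1.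
Qed.

Lemma coset_repP x y : coset_rep x = coset_rep y <-> subgroup_set N (x^-1 * y).
Proof.
split=> [xy|xy].
  have -> : x^-1 * y = (x^-1 * coset_rep x) / (y^-1 * coset_rep y).
    by rewrite xy invgM invgK -mulgA mulVKg.
  by apply: subgroup_div; exact: coset_rep_in.
(* The chosen representative depends only on the coset as a set, so equal cosets give equal
   choices. *)
congr xget; apply/seteqP; split=> z /= Nz.
  have -> : y^-1 * z = (x^-1 * y)^-1 * (x^-1 * z) by rewrite invgM invgK -mulgA mulVKg.
  by apply: subgroupM => //; exact: subgroupV.
have -> : x^-1 * z = (x^-1 * y) * (y^-1 * z) by rewrite -mulgA mulVKg.
exact: subgroupM.
Qed.

Lemma coset_repK x : coset_rep (coset_rep x) = coset_rep x.
Proof. by apply/esym/coset_repP; exact: coset_rep_in. Qed.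

Hypothesis nN : normal_subgroup N.

Lemma coset_repMl x y : coset_rep (coset_rep x * y) = coset_rep (x * y).
Proof.
apply/esym/coset_repP; rewrite invgM -mulgA.
have := nN y (coset_rep_in x); by rewrite conjgE !mulgA.
Qed.

Lemma coset_repMr x y : coset_rep (x * coset_rep y) = coset_rep (x * y).
Proof.
apply/esym/coset_repP; rewrite invgM -mulgA mulKg; exact: coset_rep_in.
Qed.

End coset_representative.

(* Elements of the quotient are encoded as chosen coset representatives.      *)
Definition discrete_quotient (G : topologicalGroupType) (N : subgroup G)
  (nN : normal_subgroup N) : Type := {x : G | coset_rep N x == x}.

Section discrete_quotient_group.
Variables (G : topologicalGroupType) (N : subgroup G) (nN : normal_subgroup N).
Local Open Scope group_scope.

HB.instance Definition _ := Choice.on (discrete_quotient nN).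

Definition coset_of (x : G) : discrete_quotient nN :=
  exist _ (coset_rep N x) (introT eqP (coset_repK N x)).

Lemma coset_of_eq x y : coset_of x = coset_of y <-> coset_rep N x = coset_rep N y.
Proof. by split=> [/(congr1 val)//|xy]; exact: val_inj. Qed.

Lemma coset_of_val (u : discrete_quotient nN) : coset_of (val u) = u.
Proof. by apply: val_inj; exact: (eqP (valP u)). Qed.

Definition quotient_mul (u v : discrete_quotient nN) := coset_of (val u * val v).
Definition quotient_inv (u : discrete_quotient nN) := coset_of (val u)^-1.

Lemma quotient_mulE x y : quotient_mul (coset_of x) (coset_of y) = coset_of (x * y).
Proof. by apply/coset_of_eq; rewrite coset_repMl // coset_repMr. Qed.

Let mulA : associative quotient_mul.
Proof.
move=> u v w; rewrite -(coset_of_val u) -(coset_of_val v) -(coset_of_val w).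
by rewrite !quotient_mulE mulgA.
Qed.
Let mul1 : left_id (coset_of 1) quotient_mul.
Proof. by move=> u; rewrite -(coset_of_val u) quotient_mulE mul1g. Qed.
Let mulr1 : right_id (coset_of 1) quotient_mul.
Proof. by move=> u; rewrite -(coset_of_val u) quotient_mulE mulg1. Qed.
Let mulV : left_inverse (coset_of 1) quotient_inv quotient_mul.
Proof. by move=> u; rewrite -[in X in quotient_mul _ X](coset_of_val u) quotient_mulE mulVg. Qed.
Let mulrV : right_inverse (coset_of 1) quotient_inv quotient_mul.
Proof. by move=> u; rewrite -[in X in quotient_mul X _](coset_of_val u) quotient_mulE mulgV. Qed.

HB.instance Definition _ :=
  isGroup.Build (discrete_quotient nN) mulA mul1 mulr1 mulV mulrV.
HB.instance Definition _ :=
  Topological.copy (discrete_quotient nN) (discrete_topology (discrete_quotient nN)).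
HB.instance Definition _ := PreTopologicalGroup.on (discrete_quotient nN).

Lemma discrete_quotient_open (A : set (discrete_quotient nN)) : open A.
Proof. exact: (@discrete_open (discrete_topology (discrete_quotient nN))). Qed.

Let nbhs1P (x : discrete_quotient nN) : nbhs x [set x].
Proof. by apply: open_nbhs_nbhs; split=> //; exact: discrete_quotient_open. Qed.

Let mulg_cts : continuous (fun xy : discrete_quotient nN * discrete_quotient nN =>
  xy.1 * xy.2).
Proof.
move=> [x y] A /nbhs_singleton /= Axy; exists ([set x], [set y]).
  by split; exact: nbhs1P.
by move=> [_ _] /= [-> ->].
Qed.

Let invg_cts : continuous (fun x : discrete_quotient nN => x^-1).
Proof.
move=> x A /nbhs_singleton /= Ax.
by apply: (@filterS _ (nbhs x) _ [set x]) => [_ ->|]; last exact: nbhs1P.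
Qed.

HB.instance Definition _ :=
  PreTopologicalGroup_isTopologicalGroup.Build (discrete_quotient nN)
    mulg_cts invg_cts.

Lemma coset_of_quotient_map : open (N : set G) ->
  is_quotient_map N (coset_of : G -> discrete_quotient nN).
Proof.
move=> oN; split.
- by move=> x y; rewrite -quotient_mulE.
- by move=> y; exists (val y); exact: coset_of_val.
- move=> x A /nbhs_singleton Ax.
  apply: (@filterS _ (nbhs x) _ [set y | subgroup_set N (x^-1 * y)]); last first.
    exact/nbhs1_mull/nbhs1_subgroup.
  move=> y /= Nxy.
  by rewrite /preimage /= (_ : coset_of y = coset_of x) //; exact/esym/coset_of_eq/coset_repP.
- by move=> A _; exact: discrete_quotient_open.
- move=> x; rewrite -[1%g]/(coset_of 1) coset_of_eq.
  split=> [/esym/coset_repP|Nx]; first by rewrite invg1 mul1g.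
  by apply/esym/coset_repP; rewrite invg1 mul1g.
Qed.

End discrete_quotient_group.

(** * Elementarity from open normal and compact subgroups *)

Lemma elementary_open_extension (G : topologicalGroupType) (N : subgroup G) :
  tdlcsc G -> open (N : set G) -> normal_subgroup N ->
  elementary (subgroup_type N) -> elementary G.
Proof.
move=> tG oN nN eN; have qN := coset_of_quotient_map nN oN.
apply: (elementary_extension tG (open_subgroup_closed oN) nN qN eN).
apply: elementary_discrete => [A|]; first exact: discrete_quotient_open.
have [_ _ _ /second_countable_dense [x dx]] := tG.
apply: sub_countable (card_image_le (coset_of nN \o x) [set: nat]) => //.
apply: subset_card_le => u _.
(* Every coset of the open $N$ meets the dense sequence, so there are countably many. *)
have [n Nn] := dx _ _ (nbhs1_mull (val u) (nbhs1_subgroup oN)).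
exists n => //=; rewrite -(coset_of_val u); apply/coset_of_eq/esym/coset_repP.
exact: Nn.
Qed.

Lemma elementary_compact_subgroup (G : topologicalGroupType) (W : subgroup G) :
  tdlcsc G -> compact (W : set G) -> elementary (subgroup_type W).
Proof.
move=> tG cW; have [hG _ _ _] := tG.
have clW := compact_closed hG cW.
have [hW tdW _ scW] := tdlcsc_closed_subgroup clW tG.
apply: elementary_profinite => //; split=> //.
rewrite (_ : [set: _] = val @^-1` (W : set G)); first exact: val_preimage_compact.
by apply/esym/seteqP; split=> // -[x Wx] _; exact: set_mem Wx.
Qed.

Lemma onat1_le n : ole (onat 1) (onat n.+1).
Proof. by apply: osucc_mono; apply/oleP => -[]. Qed.

(** * Elementarity and rank from a locally dense quasicenter *)

Section locally_dense_quasicenter.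
Variables (G : topologicalGroupType) (U : subgroup G).
Hypotheses (tG : tdlcsc G) (oU : open (U : set G)) (cU : compact (U : set G)).
Hypothesis smallU : small_normalized_subgroups U.
Hypothesis denseU : U `<=` closure (@quasicenter G).
Local Open Scope group_scope.

Let N := quasicentral_closure G.

Let clN : closed (N : set G).
Proof. exact: closed_closure. Qed.

Let oN : open (N : set G).
Proof.
by apply: subgroup_open; exact: filterS denseU (nbhs1_subgroup oU).
Qed.

(** Each compactly generated open subgroup of $N$ has an open normal subgroup inside $U$. It is
    closed in a compact set, hence profinite, and the quotient by it is countable discrete. *)
Lemma elementary_quasicentral_closure : elementary (subgroup_type N).
Proof.
have tN := tdlcsc_closed_subgroup clN tG.
have [O exO cgO] := compactly_generated_exhaustion tN.
apply: (elementary_union tN exO) => i.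
have clO : closed (O i : set (subgroup_type N)).
  by have [oO _ _] := exO; exact: open_subgroup_closed.
have fm := comp_mono (subgroup_val_mono N) (subgroup_val_mono (O i)).
have [|W [oW nW WU]] := small_open_normal oU smallU (cgO i) fm _ (filterT : nbhs 1 setT).
  by move=> x /=; exact: set_mem (valP (val x)).
have tO := tdlcsc_closed_subgroup clO tN.
apply: (elementary_open_extension tO oW nW); apply: elementary_compact_subgroup => //.
have cUO := val_preimage_compact clO (val_preimage_compact clN cU).
by apply: (subclosed_compact (open_subgroup_closed oW) cUO) => w /WU[].
Qed.

Lemma elementary_locally_dense_quasicenter : elementary G.
Proof.
apply: elementary_open_extension tG oN _ elementary_quasicentral_closure.
exact: quasicentral_closure_normal.
Qed.

Lemma elementary_Res (K : topologicalGroupType) :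
  elementary K -> elementary (subgroup_type (Res K)).
Proof.
apply: elementary_closed_subgroup; apply: closed_bigI => W [oW _].
exact: open_subgroup_closed.
Qed.

Lemma tdlcsc_Res (K : topologicalGroupType) :
  tdlcsc K -> tdlcsc (subgroup_type (Res K)).
Proof.
apply: tdlcsc_closed_subgroup; apply: closed_bigI => W [oW _].
exact: open_subgroup_closed.
Qed.

(** By [Res_trivial], all residuals in an exhaustion of $K$ are trivial and have rank $1$, so the
    recursion stops at $2$. *)
Lemma rank_quasicentral (K : topologicalGroupType) (f : K -> G) :
  tdlcsc K -> elementary K -> continuous_monomorphism f ->
  (forall x, subgroup_set N (f x)) ->
  exists2 a, decomposition_rank K a & ole a (onat 2).
Proof.
move=> tK eK fm fN.
have [K1|/existsNP nK1] := pselect (forall x : K, x = 1).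
  exists (onat 1); last exact: onat1_le.
  by apply: rank_trivial => //; split; exact: ole_refl.
have [O exO cgO] := compactly_generated_exhaustion tK.
exists (osucc (osup (fun _ : nat => onat 1))); last first.
  by apply: osucc_mono; apply: osup_le => _; exact: ole_refl.
apply: (rank_nontrivial (O := O) (r := fun=> onat 1)) => //; last first.
  by split; exact: ole_refl.
move=> i; have [oO _ _] := exO.
apply: rank_trivial; last by split; exact: ole_refl.
  apply/elementary_Res/elementary_closed_subgroup => //.
  exact: open_subgroup_closed.
have fim := comp_mono fm (subgroup_val_mono (O i)).
move=> [x Rx]; apply: val_inj => /=.
have [hG _ _ _] := tG.
apply: (Res_trivial oU smallU hG (cgO i) fim); last exact: set_mem Rx.
by move=> y; exact: fN.
Qed.

Lemma rank_locally_dense_quasicenter :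
  exists2 a, decomposition_rank G a & ole a (onat 3).
Proof.
have eG := elementary_locally_dense_quasicenter.
have [G1|/existsNP nG1] := pselect (forall x : G, x = 1).
  exists (onat 1); last exact: onat1_le.
  by apply: rank_trivial => //; split; exact: ole_refl.
have [O exO cgO] := compactly_generated_exhaustion tG.
have [oO _ _] := exO.
have /choice[r rP] i : exists a,
    decomposition_rank (subgroup_type (Res (subgroup_type (O i)))) a /\
    ole a (onat 2).
  have clO := open_subgroup_closed (oO i).
  have tO := tdlcsc_closed_subgroup clO tG.
  have fm := comp_mono (subgroup_val_mono (O i))
    (subgroup_val_mono (Res (subgroup_type (O i)))).
  have [|x|a ra a2] := rank_quasicentral (tdlcsc_Res tO) _ fm; last by exists a.
    exact/elementary_Res/elementary_closed_subgroup.
  have [vM _ vC] := subgroup_val_mono (O i).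
  (* The intersection of $N$ with [O i] is open and normal in [O i], so it contains the residual. *)
  apply: (set_mem (valP x) (Subgroup (preim_closed N vM))); split=> /=.
    by move/continuousP: vC; exact.
  by move=> y z Ny; exact: quasicentral_closure_normal.
exists (osucc (osup r)); last first.
  by apply: osucc_mono; apply: osup_le => i; exact: (rP i).2.
apply: (rank_nontrivial (O := O) (r := r)) => // [i|]; first exact: (rP i).1.
by split; exact: ole_refl.
Qed.

End locally_dense_quasicenter.

(** * Transfer from GL to the open subgroup, and conclusion *)

Section transfer_from_GL.
Context {d : Order.disp_t} {L : preorderType d}.
Variables (finL : finite_neighborhoods L) (P : pzRingType).
Variables (G : topologicalGroupType) (U : subgroup G).
Variables (f : subgroup_type U -> GL finL P) (g : GL finL P -> subgroup_type U).
Hypotheses (fM : {morph f : x y / (x * y)%g}) (fK : cancel f g) (gK : cancel g f).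
Hypotheses (fC : continuous f) (gC : continuous g) (oU : open (U : set G)).
Local Open Scope group_scope.

Let f1 : f 1 = 1.
Proof. by apply: (mulgI (f 1)); rewrite -fM !mulg1. Qed.

Let fV x : f x^-1 = (f x)^-1.
Proof. by apply/esym/mulg1_eq; rewrite -fM mulgV f1. Qed.

Let gM : {morph g : x y / (x * y)%g}.
Proof. by move=> x y; apply: (can_inj fK); rewrite fM !gK. Qed.

(** The subgroups are the block kernels, carried to $U$ by the isomorphism; they are open in $G$
    because $U$ is. *)
Lemma GL_small_normalized_subgroups : small_normalized_subgroups U.
Proof.
move=> A A1.
have : nbhs (1 : GL finL P) (g @^-1` (val @^-1` A)).
  by apply: gC; rewrite -f1 fK; exact: subgroup_val_continuous.
move=> /nbhs1_GL_block [B [fB cB BA]].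
pose W := [set x | exists2 y : subgroup_type U, block_trivial B (f y) & val y = x].
have Wclosed : group_closed (mem W).
  split=> [|x y /set_mem[u Wu <-] /set_mem[v Wv <-]]; apply/mem_set.
    by exists 1 => //; rewrite f1; exact: block_trivial1.
  exists (u / v) => //; rewrite fM fV.
  by apply: block_trivialM => //; exact: block_trivialV.
exists (Subgroup Wclosed); split.
- apply: subgroup_open.
  have near1 : nbhs (1 : subgroup_type U) (f @^-1` block_trivial B).
    by apply: fC; rewrite f1; exact: block_trivial_near.
  apply: filterS (nbhs_val oU near1) => _ [y Wy <-].
  by exists y.
- by move=> _ [y Wy <-]; rewrite -(fK y); exact: BA.
- by move=> _ [y Wy <-]; exact: set_mem (valP y).
- move=> u _ Uu [y Wy <-].
  exists (y ^ (exist _ u (mem_set Uu) : subgroup_type U)) => //.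
  by rewrite conjgE !fM fV -conjgE; exact: block_trivialJ.
Qed.

(** As $U$ is open, an element with open centralizer in $U$ has open centralizer in $G$, so density
    carries over from GL. *)
Lemma GL_dense_quasicenter : U `<=` closure (@quasicenter G).
Proof.
move=> x Ux A xA; pose u : subgroup_type U := exist _ x (mem_set Ux).
have : nbhs (f u) (g @^-1` (val @^-1` A)).
  by apply: gC; rewrite fK; exact: (subgroup_val_continuous (x := u)).
move=> /GL_quasicentral_dense [q Aq qC]; exists (val (g q)); split=> //.
have near1 : nbhs (1 : subgroup_type U) (f @^-1` [set z | q * z = z * q]).
  by apply: fC; rewrite f1.
apply: filterS (nbhs_val oU near1) => _ [y qy <-].
have qyE : g q * y = y * g q by rewrite -(fK y) -!gM qy.
exact: (congr1 val qyE).
Qed.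

End transfer_from_GL.

Theorem corollary3p22 (d : Order.disp_t) (L : preorderType d)
    (finL : finite_neighborhoods L) (P : finComNzRingType)
    (G : topologicalGroupType) (U : subgroup G) :
  tdlcsc G -> open (subgroup_set U) -> compact (subgroup_set U) ->
  topologically_isomorphic (subgroup_type U) (GL finL P) ->
  elementary G /\ (exists2 a, decomposition_rank G a & ole a (onat 3)).
Proof.
move=> tG oU cU [f [g [fM fK gK fC gC]]].
have smallU := GL_small_normalized_subgroups fM fK fC gC oU.
have denseU := GL_dense_quasicenter fM fK gK fC gC oU.
split; first exact: elementary_locally_dense_quasicenter denseU.
exact: rank_locally_dense_quasicenter denseU.
Qed.
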